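(* Let $A$ be a unital semisimple commutative complex Banach algebra and $B$ a unital complex Banach algebra, and set \[ \Omega_A=\{f\in A:\ \|f-r\|<r \text{ for some real } r>0\},\qquad \Omega_B=\{a\in B:\ \|a-r\|<r \text{ for some real } r>0\}. \] Suppose that $U$ is an open subset of $A$ with $\Omega_A\subset U\subset A^{-1}$ and $(\mathbb C\setminus\{0\})U\subset U$, and that $V$ is an open subset of $B$ with $\Omega_B\subset V\subset B^{-1}$, $(\mathbb C\setminus\{0\})V\subset V$ and $V\Omega_B\subset V$ (where $V\Omega_B=\{vw:v\in V,\ w\in\Omega_B\}$). Let $g\in B^{-1}$. If $T:U\to gV=\{gv:v\in V\}$ is a surjective isometry (with respect to the metrics induced by the norms), then $T$ extends to a surjective real linear isometry from $A$ onto $B$.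
   Context: $A^{-1}$, $B^{-1}$ denote the groups of invertible elements; for real $r$, $r$ also denotes $r1$. $T$ is only assumed to be a distance-preserving bijection between the metric spaces $U$ and $gV$, not linear. *)

(* Defs.v *)
From Stdlib Require Import Reals.
Open Scope R_scope.

Definition C : Type := (R * R)%type.
Definition Cre (z : C) : R := fst z.
Definition Cim (z : C) : R := snd z.
Definition RtoC (r : R) : C := (r, 0).
Definition C0 : C := (0, 0).
Definition C1 : C := (1, 0).
Definition Cadd (a b : C) : C := (fst a + fst b, snd a + snd b).
Definition Cmul (a b : C) : C :=
  (fst a * fst b - snd a * snd b, fst a * snd b + snd a * fst b).
Definition Cmod (a : C) : R := sqrt (fst a * fst a + snd a * snd a).

Record BanachAlg := {
  carrier :> Type;
  zero : carrier;
  one : carrier;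
  add : carrier -> carrier -> carrier;
  opp : carrier -> carrier;
  mul : carrier -> carrier -> carrier;
  scal : C -> carrier -> carrier;
  norm : carrier -> R;
  add_assoc : forall x y z, add x (add y z) = add (add x y) z;
  add_comm : forall x y, add x y = add y x;
  add_0l : forall x, add zero x = x;
  add_oppr : forall x, add x (opp x) = zero;
  scal_assoc : forall a b x, scal a (scal b x) = scal (Cmul a b) x;
  scal_1 : forall x, scal C1 x = x;
  scal_addr : forall a x y, scal a (add x y) = add (scal a x) (scal a y);
  scal_addl : forall a b x, scal (Cadd a b) x = add (scal a x) (scal b x);
  mul_assoc : forall x y z, mul x (mul y z) = mul (mul x y) z;
  mul_1l : forall x, mul one x = x;
  mul_1r : forall x, mul x one = x;
  mul_addl : forall x y z, mul (add x y) z = add (mul x z) (mul y z);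
  mul_addr : forall x y z, mul x (add y z) = add (mul x y) (mul x z);
  mul_scall : forall a x y, mul (scal a x) y = scal a (mul x y);
  mul_scalr : forall a x y, mul x (scal a y) = scal a (mul x y);
  norm_eq0 : forall x, norm x = 0 -> x = zero;
  norm_triangle : forall x y, norm (add x y) <= norm x + norm y;
  norm_scal : forall a x, norm (scal a x) = Cmod a * norm x;
  norm_mul : forall x y, norm (mul x y) <= norm x * norm y;
  norm_one : norm one = 1;
  complete : forall u : nat -> carrier,
    (forall eps, 0 < eps -> exists N, forall m n, (N <= m)%nat -> (N <= n)%nat ->
        norm (add (u m) (opp (u n))) < eps) ->
    exists l, forall eps, 0 < eps -> exists N, forall n, (N <= n)%nat ->
        norm (add (u n) (opp l)) < eps
}.

Arguments zero {_}. Arguments one {_}. Arguments add {_}. Arguments opp {_}.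
Arguments mul {_}. Arguments scal {_}. Arguments norm {_}.

Section Notions.
Variable A : BanachAlg.

Definition sub (x y : A) : A := add x (opp y).
Definition bdist (x y : A) : R := norm (sub x y).

Definition rone (r : R) : A := scal (RtoC r) one.

Definition commutative : Prop := forall x y : A, mul x y = mul y x.

Definition invertible (x : A) : Prop :=
  exists y : A, mul x y = one /\ mul y x = one.

Definition is_open (U : A -> Prop) : Prop :=
  forall x, U x -> exists eps, 0 < eps /\ forall y, bdist y x < eps -> U y.

Definition Omega (f : A) : Prop := exists r : R, 0 < r /\ bdist f (rone r) < r.

Definition cstable (U : A -> Prop) : Prop :=
  forall (c : C) (x : A), c <> C0 -> U x -> U (scal c x).

Definition left_ideal (I : A -> Prop) : Prop :=
  I zero /\ (forall x y, I x -> I y -> I (add x y)) /\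
  (forall a x, I x -> I (mul a x)).

Definition maximal_left_ideal (M : A -> Prop) : Prop :=
  left_ideal M /\ ~ M one /\
  forall I, left_ideal I -> (forall x, M x -> I x) ->
    (forall x, I x <-> M x) \/ (forall x, I x).

Definition jacobson_radical (x : A) : Prop :=
  forall M, maximal_left_ideal M -> M x.

Definition semisimple : Prop := forall x, jacobson_radical x -> x = zero.
End Notions.

Arguments sub {_}. Arguments bdist {_}. Arguments rone {_}. Arguments invertible {_}.
Arguments Omega {_}. Arguments is_open {_}. Arguments cstable {_}.

Definition real_linear {A B : BanachAlg} (S : A -> B) : Prop :=
  (forall x y, S (add x y) = add (S x) (S y)) /\
  (forall (r : R) x, S (scal (RtoC r) x) = scal (RtoC r) (S x)).

Definition isometry {A B : BanachAlg} (S : A -> B) : Prop :=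
  forall x y, bdist (S x) (S y) = bdist x y.

Definition surjective_onto {A B : BanachAlg} (S : A -> B) : Prop :=
  forall y, exists x, S x = y.

(* Main.v *)
(** The set [U] accumulates at [0], and on rays [T^-1] is affine by a local Mazur-Ulam
    theorem, so [T^-1 (r w) = a + r (T^-1 w - a)] for one [a] independent of [w].  Hence
    [U + a] is contained in [U], and since [U] is stable under nonzero complex scalars,
    [1 + c a] is invertible for all complex [c]; so [a] is quasinilpotent and [a = 0] by
    semisimplicity.  Thus [T] is positively homogeneous, and near [1] it coincides with a
    real linear isometry [L] of [A] onto [B].  Following segments inside [U], [T = L] on
    [Omega_A] and (passing from [1] to [-1] through [i]) on [-Omega_A].  For [f] in [U]
    with [T f = L (f + d)], comparing distances to [f + r] and [f - r] for large [r] gives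
    [|r - d| = |r + d| = r], and [d = 0] because the unit is an extreme point of the unit
    ball of a unital normed algebra. *)

Require Import Defs.
From Stdlib Require Import Reals Lra Lia ZArith List ClassicalEpsilon.
From Coquelicot Require Compactness.
Open Scope R_scope.

Declare Scope alg_scope.
Delimit Scope alg_scope with alg.
Bind Scope alg_scope with carrier.
Arguments add {_} (_ _)%_alg.
Arguments sub {_} (_ _)%_alg.
Arguments opp {_} _%_alg.
Arguments mul {_} (_ _)%_alg.
Arguments scal {_} _ _%_alg.
Arguments norm {_} _%_alg.
Notation "x + y" := (add x y) : alg_scope.
Notation "x - y" := (sub x y) : alg_scope.
Notation "- x" := (opp x) : alg_scope.
Notation "x * y" := (mul x y) : alg_scope.
Notation "r *: x" := (scal (RtoC r) x%alg) (at level 40, left associativity).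

Lemma C_ext (a b : Defs.C) : fst a = fst b -> snd a = snd b -> a = b.
Proof. destruct a, b; simpl; congruence. Qed.

Lemma Cmod_RtoC (r : R) : Cmod (RtoC r) = Rabs r.
Proof.
  unfold Cmod, RtoC; simpl.
  replace (r * r + 0 * 0) with (Rsqr r) by (unfold Rsqr; ring).
  apply sqrt_Rsqr_abs.
Qed.

(** * Real linear combinations *)

Section RealModule.
Variable A : BanachAlg.
Implicit Types x y z : A.

Lemma rscal_assoc (r s : R) x : r *: (s *: x) = (r * s) *: x.
Proof.
  rewrite scal_assoc; f_equal. apply C_ext; unfold RtoC, Cmul; simpl; ring.
Qed.

Lemma rscal_addl (r s : R) x : (r + s) *: x = (r *: x + s *: x)%alg.
Proof.
  rewrite <- scal_addl; f_equal. apply C_ext; unfold RtoC, Cadd; simpl; ring.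
Qed.

Lemma rscal_1 x : 1 *: x = x.
Proof. apply scal_1. Qed.

Lemma add_0r x : (x + zero)%alg = x.
Proof. rewrite add_comm; apply add_0l. Qed.

Lemma add_cancel x y z : (x + y)%alg = (x + z)%alg -> y = z.
Proof.
  intro H.
  rewrite <- (add_0l _ y), <- (add_0l _ z), <- (add_oppr _ x), (add_comm _ x).
  rewrite <- !add_assoc, H; reflexivity.
Qed.

Lemma rscal_0 x : 0 *: x = zero.
Proof.
  apply (add_cancel (0 *: x)). rewrite <- rscal_addl, add_0r. f_equal. f_equal. ring.
Qed.

Lemma rscal_zero (r : R) : r *: (zero : A) = zero.
Proof.
  apply (add_cancel (r *: zero)). rewrite <- scal_addr, !add_0r. reflexivity.
Qed.

Lemma opp_rscal x : (- x)%alg = (-1) *: x.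
Proof.
  apply (add_cancel x). rewrite add_oppr. rewrite <- (rscal_1 x) at 1.
  rewrite <- rscal_addl. replace (1 + -1) with 0 by ring. rewrite rscal_0; reflexivity.
Qed.

(** * A reflective decision procedure for real linear identities *)

Inductive lin_expr :=
| LVar (n : nat) | LZero | LAdd (e f : lin_expr) | LOpp (e : lin_expr)
| LScal (r : R) (e : lin_expr).

Fixpoint lin_eval (env : list A) (e : lin_expr) : A :=
  match e with
  | LVar n => nth n env zero
  | LZero => zero
  | LAdd e f => add (lin_eval env e) (lin_eval env f)
  | LOpp e => opp (lin_eval env e)
  | LScal r e => r *: lin_eval env e
  end.

Fixpoint lin_coef (e : lin_expr) (i : nat) : R :=
  match e with
  | LVar n => if Nat.eqb i n then 1 else 0
  | LZero => 0
  | LAdd e f => lin_coef e i + lin_coef f i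
  | LOpp e => - lin_coef e i
  | LScal r e => r * lin_coef e i
  end.

Fixpoint lin_comb (env : list A) (c : nat -> R) : A :=
  match env with
  | nil => zero
  | x :: l => add (c O *: x) (lin_comb l (fun i => c (S i)))
  end.

(** Recursion on [n] lets [simpl] turn agreement into a finite conjunction of real equations, one
    per atom. *)
Fixpoint agree (n : nat) (c d : nat -> R) : Prop :=
  match n with
  | O => True
  | S m => c O = d O /\ agree m (fun i => c (S i)) (fun i => d (S i))
  end.

Lemma lin_comb_agree env c d : agree (length env) c d -> lin_comb env c = lin_comb env d.
Proof.
  revert c d; induction env as [|x l IH]; intros c d H; simpl in *; [reflexivity|].
  destruct H as [H0 H]. rewrite H0, (IH _ _ H); reflexivity.
Qed.

Lemma lin_comb_0 env : lin_comb env (fun _ => 0) = zero.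
Proof.
  induction env as [|x l IH]; simpl; [reflexivity|]. rewrite IH, rscal_0. apply add_0l.
Qed.

Lemma lin_comb_add env c d :
  lin_comb env (fun i => c i + d i) = (lin_comb env c + lin_comb env d)%alg.
Proof.
  revert c d; induction env as [|x l IH]; intros c d; simpl.
  - rewrite add_0l; reflexivity.
  - rewrite (IH (fun i => c (S i)) (fun i => d (S i))), rscal_addl.
    rewrite <- !add_assoc; f_equal. rewrite !add_assoc; f_equal. apply add_comm.
Qed.

Lemma lin_comb_scal env r c : lin_comb env (fun i => r * c i) = r *: lin_comb env c.
Proof.
  revert c; induction env as [|x l IH]; intros c; simpl.
  - rewrite rscal_zero; reflexivity.
  - rewrite (IH (fun i => c (S i))), scal_addr, rscal_assoc; reflexivity.
Qed.

Lemma agree_ext n c d : (forall i, c i = d i) -> agree n c d.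
Proof.
  revert c d; induction n as [|n IH]; intros c d H; simpl; auto.
Qed.

Lemma lin_eval_comb env e : lin_eval env e = lin_comb env (lin_coef e).
Proof.
  induction e as [n| |e IHe f IHf|e IHe|r e IHe]; simpl.
  - revert n; induction env as [|x l IH]; intros [|n]; simpl; try reflexivity.
    + rewrite lin_comb_0, rscal_1, add_0r; reflexivity.
    + rewrite IH, rscal_0, add_0l; reflexivity.
  - rewrite lin_comb_0; reflexivity.
  - rewrite lin_comb_add, IHe, IHf; reflexivity.
  - rewrite IHe, opp_rscal, <- lin_comb_scal. apply lin_comb_agree, agree_ext.
    intro i; ring.
  - rewrite lin_comb_scal, IHe; reflexivity.
Qed.

Lemma lin_eval_eq env e f :
  agree (length env) (lin_coef e) (lin_coef f) -> lin_eval env e = lin_eval env f.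
Proof. rewrite !lin_eval_comb; apply lin_comb_agree. Qed.

End RealModule.

Ltac mem_atom x l :=
  lazymatch l with
  | nil => constr:(false)
  | x :: _ => constr:(true)
  | _ :: ?l' => mem_atom x l'
  end.

Ltac atoms e l :=
  lazymatch e with
  | add ?a ?b => let l1 := atoms a l in atoms b l1
  | sub ?a ?b => let l1 := atoms a l in atoms b l1
  | opp ?a => atoms a l
  | zero => l
  | scal (RtoC _) ?a => atoms a l
  | _ => let b := mem_atom e l in
         lazymatch b with true => l | false => constr:(e :: l) end
  end.

Ltac atom_index x l :=
  lazymatch l with
  | x :: _ => constr:(O)
  | _ :: ?l' => let n := atom_index x l' in constr:(S n)
  end.

Ltac reify_lin e l :=
  lazymatch e with
  | add ?a ?b => let a' := reify_lin a l in let b' := reify_lin b l in constr:(LAdd a' b')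
  | sub ?a ?b => let a' := reify_lin a l in let b' := reify_lin b l in constr:(LAdd a' (LOpp b'))
  | opp ?a => let a' := reify_lin a l in constr:(LOpp a')
  | zero => constr:(LZero)
  | scal (RtoC ?r) ?a => let a' := reify_lin a l in constr:(LScal r a')
  | _ => let n := atom_index e l in constr:(LVar n)
  end.

Ltac vec_reduce :=
  unfold rone;
  lazymatch goal with
  | |- @eq ?T ?a ?b =>
    lazymatch type of a with
    | carrier ?A =>
      let l0 := atoms a (@nil (carrier A)) in
      let l := atoms b l0 in
      let a' := reify_lin a l in
      let b' := reify_lin b l in
      change (lin_eval A l a' = lin_eval A l b');
      apply lin_eval_eq; simpl; repeat split
    end
  end.

(** Each goal left by reification compares the coefficients of one atom; [field; lra] covers
    inverses of scalars that the context shows to be nonzero. *)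
Ltac vec := vec_reduce; first [ring | lra | (field; lra) | idtac].

Ltac mul_expand :=
  unfold sub, rone; rewrite ?opp_rscal;
  repeat rewrite ?mul_addl, ?mul_addr, ?mul_scall, ?mul_scalr, ?mul_1l, ?mul_1r, ?rscal_assoc.

(** * Norms *)

Section Norm.
Variable A : BanachAlg.
Implicit Types x y z : A.

Lemma norm_rscal (r : R) x : norm (r *: x) = Rabs r * norm x.
Proof. rewrite norm_scal, Cmod_RtoC; reflexivity. Qed.

Lemma norm_zero : norm (zero : A) = 0.
Proof. rewrite <- (rscal_0 A zero), norm_rscal, Rabs_R0; ring. Qed.

Lemma norm_opp x : norm (- x) = norm x.
Proof. rewrite opp_rscal, norm_rscal, Rabs_left by lra; ring. Qed.

Lemma norm_ge0 x : 0 <= norm x.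
Proof.
  pose proof (norm_triangle _ x (opp x)) as H.
  rewrite add_oppr, norm_zero, norm_opp in H. lra.
Qed.

Lemma norm_small_eq0 x (k : R) : (forall e, 0 < e -> norm x <= k * e) -> x = zero.
Proof.
  intro H. apply norm_eq0. pose proof (norm_ge0 x) as H0.
  destruct (Rle_lt_or_eq_dec _ _ H0) as [Hp|]; [exfalso|congruence].
  pose proof (Rabs_pos k) as Hk.
  (* With this [e] the bound [k * e] stays below [norm x / 2]. *)
  assert (He : 0 < norm x / (2 * (Rabs k + 1))) by (apply Rdiv_lt_0_compat; lra).
  specialize (H _ He).
  assert (Hm : k * (norm x / (2 * (Rabs k + 1))) <= Rabs k * (norm x / (2 * (Rabs k + 1)))).
  { apply Rmult_le_compat_r; [lra|apply Rle_abs]. }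
  assert (Hf : Rabs k * (norm x / (2 * (Rabs k + 1)))
             = norm x / 2 - norm x / (2 * (Rabs k + 1))) by (field; lra).
  lra.
Qed.

Lemma sub_eq0 x y : (x - y)%alg = zero -> x = y.
Proof.
  intro H. transitivity (x - y + y)%alg; [vec|]. rewrite H; vec.
Qed.

Lemma norm_sub_sym x y : norm (x - y) = norm (y - x).
Proof. rewrite <- norm_opp. f_equal; vec. Qed.

Lemma norm_sub_triangle x y z : norm (x - z) <= norm (x - y) + norm (y - z).
Proof.
  replace (x - z)%alg with ((x - y) + (y - z))%alg by vec. apply norm_triangle.
Qed.

Lemma bdist_eq0 x y : bdist x y = 0 -> x = y.
Proof. intro H. apply sub_eq0, norm_eq0, H. Qed.

Lemma norm_rone (r : R) : norm (rone r : A) = Rabs r.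
Proof. unfold rone; rewrite norm_rscal, norm_one; ring. Qed.

(* Since [s + (n+1) x = 1/2 ((1+x)(s+1+nx) + (1-x)(s-1+nx))], the norm of [s + n x] is at
   most the expectation of [|s + S_n|] for a simple random walk [S_n]; the right-hand side
   is the expectation of the upper bound [(u^2 + t^2) / (2t)] of [|u|] at [u = s + S_n]. *)
Lemma norm_walk x (t : R) : 0 < t ->
  norm (one + x) <= 1 -> norm (one - x) <= 1 ->
  forall (n : nat) (s : R), norm (rone s + INR n *: x) <= (s * s + INR n + t * t) / (2 * t).
Proof.
  intros Ht Hp Hm n; induction n as [|n IH]; intro s.
  - replace (rone s + INR 0 *: x)%alg with (rone s : A) by (simpl; vec).
    rewrite norm_rone. simpl. apply (Rmult_le_reg_r (2 * t)); [lra|].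
    replace ((s * s + 0 + t * t) / (2 * t) * (2 * t)) with (s * s + t * t) by (field; lra).
    pose proof (Rle_0_sqr (s - t)). pose proof (Rle_0_sqr (s + t)). unfold Rsqr in *.
    unfold Rabs; destruct Rcase_abs; nra.
  - rewrite S_INR.
    replace (rone s + (INR n + 1) *: x)%alg with
      ((/2) *: ((one + x) * (rone (s + 1) + INR n *: x)
               + (one - x) * (rone (s - 1) + INR n *: x)))%alg by (mul_expand; vec).
    rewrite norm_rscal, (Rabs_pos_eq (/2)) by lra.
    pose proof (norm_triangle _ ((one + x) * (rone (s + 1) + INR n *: x))
               ((one - x) * (rone (s - 1) + INR n *: x)))%alg as H.
    pose proof (norm_mul _ (one + x) (rone (s + 1) + INR n *: x))%alg as H1.
    pose proof (norm_mul _ (one - x) (rone (s - 1) + INR n *: x))%alg as H2.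
    pose proof (IH (s + 1)) as I1. pose proof (IH (s - 1)) as I2.
    pose proof (norm_ge0 (rone (s + 1) + INR n *: x)%alg) as J1.
    pose proof (norm_ge0 (rone (s - 1) + INR n *: x)%alg) as J2.
    assert (E : (s * s + (INR n + 1) + t * t) / (2 * t)
      = / 2 * (((s + 1) * (s + 1) + INR n + t * t) / (2 * t)
              + ((s - 1) * (s - 1) + INR n + t * t) / (2 * t))) by (field; lra).
    rewrite E. nra.
Qed.

(** Take [s = 0] and [t = n e] in [norm_walk] and divide by [n]: [norm x] is at most
    [(1/n + e^2) / (2e)], which is below [e] once [1/n < e^2]. *)
Lemma one_extreme x : norm (one + x) <= 1 -> norm (one - x) <= 1 -> x = zero.
Proof.
  intros Hp Hm. apply (norm_small_eq0 x 2). intros e He.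
  destruct (archimed_cor1 (e * e)) as [n [Hn Hn0]]; [nra|].
  assert (Hn1 : 0 < INR n) by (apply lt_0_INR; exact Hn0).
  assert (Ht : 0 < INR n * e) by nra.
  pose proof (norm_walk x _ Ht Hp Hm n 0) as H.
  replace (rone 0 + INR n *: x)%alg with (INR n *: x)%alg in H by vec.
  rewrite norm_rscal, Rabs_pos_eq in H by lra.
  assert (E : (0 * 0 + INR n + INR n * e * (INR n * e)) / (2 * (INR n * e))
            = INR n * ((/ INR n + e * e) / (2 * e))) by (field; lra).
  rewrite E in H. apply Rmult_le_reg_l in H; [|exact Hn1].
  apply (Rle_trans _ _ _ H). apply (Rmult_le_reg_r (2 * e)); [lra|].
  replace ((/ INR n + e * e) / (2 * e) * (2 * e)) with (/ INR n + e * e) by (field; lra).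
  nra.
Qed.

End Norm.

(** * A local Mazur-Ulam theorem *)

Definition midpoint {A : BanachAlg} (x y : A) : A := (/2) *: (x + y).

Section Midpoint.
Variable A : BanachAlg.
Implicit Types x y u v : A.

(* Metrically defined sets, shrinking to the midpoint of [x] and [y]. *)
Fixpoint mid_set x y (n : nat) (u : A) : Prop :=
  match n with
  | O => norm (u - x) = norm (x - y) / 2 /\ norm (u - y) = norm (x - y) / 2
  | S m => mid_set x y m u /\
           forall v, mid_set x y m v -> norm (u - v) <= norm (x - y) / 2 ^ S m
  end.

Lemma mid_set_0 x y n u : mid_set x y n u -> mid_set x y 0 u.
Proof. induction n as [|n IH]; [auto|]. intros [H _]; auto. Qed.

Lemma mid_set_diam x y n u v :
  mid_set x y n u -> mid_set x y n v -> norm (u - v) <= norm (x - y) / 2 ^ n.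
Proof.
  destruct n as [|n].
  - intros [Hu _] [Hv _]. pose proof (norm_sub_triangle _ u x v) as H.
    rewrite (norm_sub_sym _ x v) in H. simpl. lra.
  - intros [_ Hu] [Hv _]. auto.
Qed.

(** Both halves are proved together: if [v] is in the set, so is its reflection [x + y - v], and the
    midpoint lies halfway between them, so its distance to [v] is at most half the diameter. *)
Lemma mid_set_midpoint x y n :
  mid_set x y n (midpoint x y) /\
  forall u, mid_set x y n u -> mid_set x y n (x + y - u)%alg.
Proof.
  induction n as [|n [IHm IHs]].
  - split.
    + split; unfold midpoint.
      * replace ((/2) *: (x + y) - x)%alg with ((-/2) *: (x - y))%alg by vec.
        rewrite norm_rscal, Rabs_left by lra. lra.
      * replace ((/2) *: (x + y) - y)%alg with ((/2) *: (x - y))%alg by vec.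
        rewrite norm_rscal, Rabs_pos_eq by lra. lra.
    + intros u [H1 H2]. split.
      * replace (x + y - u - x)%alg with (y - u)%alg by vec. rewrite norm_sub_sym; auto.
      * replace (x + y - u - y)%alg with (x - u)%alg by vec. rewrite norm_sub_sym; auto.
  - split.
    + split; [exact IHm|]. intros v Hv.
      pose proof (mid_set_diam _ _ _ _ _ (IHs v Hv) Hv) as H.
      replace (midpoint x y - v)%alg with ((/2) *: (x + y - v - v))%alg
        by (unfold midpoint; vec).
      rewrite norm_rscal, Rabs_pos_eq by lra.
      pose proof (pow_lt 2 n ltac:(lra)).
      replace (norm (x - y) / 2 ^ S n) with (/2 * (norm (x - y) / 2 ^ n))
        by (simpl; field; lra).
      lra.
    + intros u [Hu Hv]. split; [auto|]. intros v Hvn.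
      replace (x + y - u - v)%alg with (- (u - (x + y - v)))%alg by vec.
      rewrite norm_opp. auto.
Qed.

Lemma mid_set_unique x y u : (forall n, mid_set x y n u) -> u = midpoint x y.
Proof.
  intro H. apply sub_eq0, (norm_small_eq0 _ _ (norm (x - y))). intros e He.
  destruct (pow_lt_1_zero (/2) ltac:(rewrite Rabs_pos_eq; lra) e He) as [N HN].
  specialize (HN N (le_n _)).
  rewrite Rabs_pos_eq in HN by (apply pow_le; lra).
  eapply Rle_trans.
  - exact (mid_set_diam _ _ _ _ _ (H N) (proj1 (mid_set_midpoint x y N))).
  - unfold Rdiv. rewrite <- pow_inv. apply Rmult_le_compat_l; [apply norm_ge0|lra].
Qed.

End Midpoint.

Definition iso_between {A B : BanachAlg} (D : A -> Prop) (E : B -> Prop) (T : A -> B) : Prop :=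
  (forall x, D x -> E (T x)) /\
  (forall y, E y -> exists x, D x /\ T x = y) /\
  (forall x y, D x -> D y -> bdist (T x) (T y) = bdist x y).

Definition ball {A : BanachAlg} (f : A) (d : R) (x : A) : Prop := bdist x f < d.

Section LocalMazurUlam.
Variables (A B : BanachAlg) (D : A -> Prop) (E : B -> Prop) (T : A -> B).
Hypothesis HT : iso_between D E T.

Lemma iso_between_inverse :
  exists P : B -> A, iso_between E D P /\ (forall y, E y -> T (P y) = y) /\
    (forall x, D x -> P (T x) = x).
Proof.
  destruct HT as [Hm [Ho Hi]].
  destruct (choice (fun y x => E y -> D x /\ T x = y)) as [P HP].
  { intro y. destruct (classic (E y)) as [Hy|Hy].
    - destruct (Ho y Hy) as [x Hx]. exists x; auto.
    (* [zero] is the default value of [P] off [E]. *)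
    - exists zero; tauto. }
  assert (HPT : forall x, D x -> P (T x) = x).
  { intros x Hx. destruct (HP _ (Hm x Hx)) as [H1 H2].
    apply bdist_eq0. rewrite <- Hi, H2 by assumption.
    unfold bdist, sub. rewrite add_oppr. apply norm_zero. }
  exists P. split; [split; [|split]|split].
  - intros y Hy; apply HP, Hy.
  - intros x Hx; exists (T x); auto.
  - intros y z Hy Hz. destruct (HP y Hy) as [H1 H2]. destruct (HP z Hz) as [H3 H4].
    rewrite <- Hi, H2, H4 by assumption. reflexivity.
  - intros y Hy; apply HP, Hy.
  - exact HPT.
Qed.

(** The sets are defined by distances alone, but with [v] ranging over the whole space. The two
    inclusions confine every such [v] to [D] or [E], where [T] matches them up. *)
Lemma mid_set_image x y :
  D x -> D y ->
  (forall u, mid_set A x y 0 u -> D u) -> (forall v, mid_set B (T x) (T y) 0 v -> E v) ->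
  forall n u, D u -> (mid_set A x y n u <-> mid_set B (T x) (T y) n (T u)).
Proof.
  destruct HT as [Hm [Ho Hi]]. unfold bdist in Hi.
  intros Hx Hy HD HE n; induction n as [|n IH]; intros u Hu; simpl.
  - rewrite !Hi by assumption. reflexivity.
  - rewrite <- IH, (Hi x y) by assumption. split; intros [H1 H2]; split; auto.
    + intros v Hv. destruct (Ho v) as [w [Hw <-]]; [apply HE; eapply mid_set_0, Hv|].
      rewrite Hi by assumption. apply H2, IH; assumption.
    + intros v Hv. assert (Hd : D v) by (apply HD; eapply mid_set_0, Hv).
      rewrite <- Hi by assumption. apply H2, IH; assumption.
Qed.

Lemma iso_midpoint x y :
  D x -> D y ->
  (forall u, mid_set A x y 0 u -> D u) -> (forall v, mid_set B (T x) (T y) 0 v -> E v) ->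
  T (midpoint x y) = midpoint (T x) (T y).
Proof.
  intros Hx Hy HD HE. apply mid_set_unique. intro n.
  assert (Hd : D (midpoint x y)) by (apply HD, mid_set_midpoint).
  apply (mid_set_image x y Hx Hy HD HE n _ Hd), mid_set_midpoint.
Qed.

End LocalMazurUlam.

(** Here [norm (x - y) < d], so [u] is within [d / 2] of [x], which is within [d / 2] of [f]. Hence
    the halved radii below. *)
Lemma mid_set_ball {A : BanachAlg} (f x y u : A) (d : R) :
  ball f (d / 2) x -> ball f (d / 2) y -> mid_set A x y 0 u -> ball f d u.
Proof.
  unfold ball, bdist. intros Hx Hy [H1 H2].
  pose proof (norm_sub_triangle _ u x f). pose proof (norm_sub_triangle _ x f y).
  rewrite (norm_sub_sym _ f y) in *. lra.
Qed.

(** * Additive norm-preserving maps are real linear *)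

Section Additive.
Variables (A B : BanachAlg) (L : A -> B).
Hypothesis Ladd : forall x y, L (x + y)%alg = (L x + L y)%alg.
Hypothesis Lnorm : forall x, norm (L x) = norm x.

Lemma additive_nat (n : nat) x : L (INR n *: x) = INR n *: L x.
Proof.
  induction n as [|n IH].
  - simpl. rewrite !rscal_0. apply norm_eq0. rewrite Lnorm. apply norm_zero.
  - rewrite S_INR, !rscal_addl, Ladd, IH, !rscal_1; reflexivity.
Qed.

Lemma additive_opp x : L (- x)%alg = (- L x)%alg.
Proof.
  apply (add_cancel _ (L x)). rewrite <- Ladd, !add_oppr.
  apply norm_eq0. rewrite Lnorm. apply norm_zero.
Qed.

(** Choose [p / q] just below [r]. Additivity cancels the integer multiples, so [q] times the defect
    is the defect for the scalar [q r - p] in [[0, 1)], of norm at most [2 * norm x]; then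
    [1 / q < e] finishes. *)
Lemma additive_rscal (r : R) x : L (r *: x) = r *: L x.
Proof.
  assert (Hpos : forall r, 0 <= r -> L (r *: x) = r *: L x).
  { clear r; intros r Hr. apply sub_eq0, (norm_small_eq0 _ _ (2 * norm x)).
    intros e He. destruct (archimed_cor1 e He) as [q [Hq Hq0]].
    assert (Hq1 : 0 < INR q) by (apply lt_0_INR; exact Hq0).
    assert (Hp : exists p, INR p <= INR q * r < INR p + 1).
    { destruct (archimed (INR q * r)) as [U1 U2].
      assert (H0 : 0 <= INR q * r) by nra.
      assert (Hz : (0 < up (INR q * r))%Z) by (apply lt_IZR; lra).
      exists (Z.to_nat (up (INR q * r) - 1)). rewrite INR_IZR_INZ, Z2Nat.id by lia.
      rewrite minus_IZR. lra. }
    destruct Hp as [p Hp].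
    assert (E1 : (INR q *: (L (r *: x) - r *: L x)
      = L ((INR q * r - INR p) *: x) - (INR q * r - INR p) *: L x)%alg).
    { replace ((INR q * r - INR p) *: x)%alg with (INR q *: (r *: x) + - (INR p *: x))%alg by vec.
      rewrite Ladd, additive_opp, !additive_nat. vec. }
    assert (E2 : norm (INR q *: (L (r *: x) - r *: L x)) <= 2 * norm x).
    { rewrite E1. eapply Rle_trans; [apply norm_triangle|].
      rewrite norm_opp, Lnorm, !norm_rscal, Lnorm, Rabs_pos_eq by lra.
      pose proof (norm_ge0 _ x). nra. }
    rewrite norm_rscal, Rabs_pos_eq in E2 by lra.
    apply (Rmult_le_reg_l (INR q)); [exact Hq1|].
    apply (Rle_trans _ _ _ E2).
    assert (1 <= INR q * e).
    { apply Rlt_le, (Rmult_lt_reg_l (/ INR q)); [apply Rinv_0_lt_compat; lra|].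
      rewrite <- Rmult_assoc, Rinv_l, Rmult_1_r, Rmult_1_l by lra. exact Hq. }
    pose proof (norm_ge0 _ x). nra. }
  destruct (Rle_lt_dec 0 r) as [H|H]; [auto|].
  replace (r *: x)%alg with (- ((-r) *: x))%alg by vec.
  rewrite additive_opp, Hpos by lra. vec.
Qed.

End Additive.

(** * Germs of affine isometries *)

Record affine_isometry {A B : BanachAlg} (c : B) (L G : A -> B) : Prop := {
  aff_linear : real_linear L;
  aff_isometry : isometry L;
  aff_eq : forall x, G x = (c + L x)%alg }.

Definition germ {A B : BanachAlg} (T G : A -> B) (f : A) : Prop :=
  exists d, 0 < d /\ forall x, bdist x f < d -> T x = G x.

Lemma pow2_dominates (r d : R) : 0 < d -> exists N, forall n, (N <= n)%nat -> r < 2 ^ n * d.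
Proof.
  intro Hd. destruct (Pow_x_infinity 2 ltac:(rewrite Rabs_pos_eq; lra) (r / d + 1)) as [N HN].
  exists N; intros n Hn. specialize (HN n Hn).
  rewrite Rabs_pos_eq in HN by (apply pow_le; lra).
  assert (E : r = r / d * d) by (field; lra). rewrite E. apply Rmult_lt_compat_r; lra.
Qed.

Section LocalAffine.
Variables (A B : BanachAlg) (phi : A -> B) (d : R).
Hypothesis Hd : 0 < d.
Hypothesis phi_mid : forall h k, norm h < d -> norm k < d ->
  phi (midpoint h k) = midpoint (phi h) (phi k).
Hypothesis phi_norm : forall h, norm h < d -> norm (phi h) = norm h.

Lemma phi_zero : phi zero = zero.
Proof. apply norm_eq0. rewrite phi_norm; rewrite norm_zero; auto. Qed.

Lemma phi_half h : norm h < d -> phi ((/2) *: h) = (/2) *: phi h.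
Proof.
  intro H. replace ((/2) *: h) with (midpoint h zero) by (unfold midpoint; vec).
  rewrite phi_mid, phi_zero; [unfold midpoint; vec|exact H|rewrite norm_zero; exact Hd].
Qed.

Lemma phi_add h k : norm h < d -> norm k < d -> norm (h + k) < d ->
  phi (h + k)%alg = (phi h + phi k)%alg.
Proof.
  intros H1 H2 H3.
  assert (E : (/2) *: phi (h + k)%alg = (/2) *: (phi h + phi k)%alg).
  { rewrite <- phi_half by exact H3. apply phi_mid; assumption. }
  transitivity (2 *: ((/2) *: phi (h + k)%alg))%alg; [vec|]. rewrite E. vec.
Qed.

Lemma norm_div_pow2 (h : A) n : norm h < 2 ^ n * d -> norm ((/ 2 ^ n) *: h) < d.
Proof.
  intro H. pose proof (pow_lt 2 n ltac:(lra)) as Hp.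
  rewrite norm_rscal, Rabs_pos_eq by (left; apply Rinv_0_lt_compat, Hp).
  apply (Rmult_lt_reg_l (2 ^ n)); [exact Hp|].
  rewrite <- Rmult_assoc, Rinv_r, Rmult_1_l by lra. exact H.
Qed.

(** This makes [2^n phi(h / 2^n)] independent of [n] as soon as [h / 2^n] lies in the ball, so that
    it can define the global extension. *)
Lemma phi_rescale h n m : norm h < 2 ^ n * d ->
  2 ^ (m + n) *: phi ((/ 2 ^ (m + n)) *: h) = 2 ^ n *: phi ((/ 2 ^ n) *: h).
Proof.
  intro H. pose proof (pow_lt 2 n ltac:(lra)) as Hn.
  induction m as [|m IH]; [reflexivity|]. rewrite <- IH.
  pose proof (pow_lt 2 m ltac:(lra)) as Hm.
  simpl (S m + n)%nat. simpl pow.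
  assert (Hk : norm ((/ 2 ^ (m + n)) *: h) < d).
  { apply norm_div_pow2. apply (Rlt_le_trans _ _ _ H).
    rewrite pow_add. pose proof (pow_R1_Rle 2 m ltac:(lra)).
    pose proof (Rmult_lt_0_compat _ _ Hn Hd). nra. }
  pose proof (pow_lt 2 (m + n) ltac:(lra)) as Hmn.
  replace ((/ (2 * 2 ^ (m + n))) *: h) with ((/2) *: ((/ 2 ^ (m + n)) *: h)) by vec.
  rewrite phi_half by exact Hk. vec.
Qed.

Lemma local_additive_extension :
  exists L : A -> B, real_linear L /\ isometry L /\ forall h, norm h < d -> L h = phi h.
Proof.
  (* The chosen value must agree with the rescaled one for every admissible [n], so that a single
     large exponent can later serve [x], [y] and [x + y] at once. *)
  destruct (choice (fun h y => forall n, norm h < 2 ^ n * d ->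
    y = 2 ^ n *: phi ((/ 2 ^ n) *: h))) as [L HL].
  { intro h. destruct (pow2_dominates (norm h) d Hd) as [N HN].
    exists (2 ^ N *: phi ((/ 2 ^ N) *: h)). intros n Hn.
    destruct (Nat.le_ge_cases n N) as [H|H].
    - replace N with ((N - n) + n)%nat by lia. apply phi_rescale, Hn.
    - replace n with ((n - N) + N)%nat by lia. symmetry; apply phi_rescale, HN, le_n. }
  assert (Ladd : forall x y, L (x + y)%alg = (L x + L y)%alg).
  { intros x y.
    destruct (pow2_dominates (norm x + norm y) d Hd) as [N HN]. specialize (HN N (le_n _)).
    pose proof (norm_ge0 _ x). pose proof (norm_ge0 _ y). pose proof (norm_triangle _ x y).
    rewrite (HL (x + y)%alg N), (HL x N), (HL y N) by lra.
    replace ((/ 2 ^ N) *: (x + y))%alg with ((/ 2 ^ N) *: x + (/ 2 ^ N) *: y)%alg by vec.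
    rewrite phi_add; [vec|apply norm_div_pow2; lra|apply norm_div_pow2; lra|].
    rewrite <- scal_addr. apply norm_div_pow2; lra. }
  assert (Lnorm : forall x, norm (L x) = norm x).
  { intro x. destruct (pow2_dominates (norm x) d Hd) as [N HN]. specialize (HN N (le_n _)).
    pose proof (pow_lt 2 N ltac:(lra)) as Hp.
    rewrite (HL x N HN), norm_rscal, phi_norm by (apply norm_div_pow2, HN).
    rewrite norm_rscal, <- Rmult_assoc, <- Rabs_mult, Rinv_r, Rabs_R1 by lra. ring. }
  exists L. split; [split|split].
  - exact Ladd.
  - intros r x. apply additive_rscal; assumption.
  - intros x y. unfold bdist, sub. rewrite <- (additive_opp _ _ L Ladd Lnorm), <- Ladd.
    apply Lnorm.
  - intros h Hh. rewrite (HL h 0%nat) by (simpl; lra). simpl.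
    replace ((/1) *: h) with h by vec. vec.
Qed.

End LocalAffine.

(** Recentre at [f]: the map [phi h = T (f + h) - T f] preserves midpoints and norms on a small
    ball, hence extends to a real linear isometry. *)
Lemma local_mazur_ulam {A B : BanachAlg} (U : A -> Prop) (W : B -> Prop) (T : A -> B) (f : A) :
  iso_between U W T -> is_open U -> is_open W -> U f ->
  exists c L G, affine_isometry c L G /\ germ T G f.
Proof.
  intros [Tm [To Ti]] HU HW Hf.
  destruct (HU f Hf) as [d1 [Hd1 HU1]]. destruct (HW (T f) (Tm f Hf)) as [d2 [Hd2 HW2]].
  (* With a common radius, [T] restricts to a bijection between the [d]-balls about [f] and [T f],
     since it preserves the distance to the centre. *)
  set (d := Rmin d1 d2).
  assert (Hd : 0 < d) by (apply Rmin_glb_lt; assumption).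
  assert (HU' : forall x, ball f d x -> U x).
  { intros x Hx. apply HU1. apply (Rlt_le_trans _ _ _ Hx), Rmin_l. }
  assert (HW' : forall y, ball (T f) d y -> W y).
  { intros y Hy. apply HW2. apply (Rlt_le_trans _ _ _ Hy), Rmin_r. }
  assert (Hiso : iso_between (ball f d) (ball (T f) d) T).
  { split; [|split].
    - intros x Hx. unfold ball. rewrite Ti; auto.
    - intros y Hy. destruct (To y (HW' y Hy)) as [x [Hx <-]]. exists x; split; auto.
      unfold ball in *. rewrite Ti in Hy; auto.
    - intros x y Hx Hy; auto. }
  assert (Hball : forall h, norm h < d / 2 -> ball f (d / 2) (f + h)%alg).
  { intros h Hh. unfold ball, bdist. replace (f + h - f)%alg with h by vec. exact Hh. }
  assert (Hincl : forall x, ball f (d / 2) x -> ball f d x) by (unfold ball; intros; lra).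
  set (phi := fun h => (T (f + h) - T f)%alg).
  destruct (local_additive_extension A B phi (d / 2)) as [L [Llin [Liso HL]]].
  - lra.
  - intros h k Hh Hk. unfold phi.
    replace (f + midpoint h k)%alg with (midpoint (f + h) (f + k))%alg by (unfold midpoint; vec).
    rewrite (iso_midpoint A B _ _ T Hiso (f + h)%alg (f + k)%alg).
    + unfold midpoint; vec.
    + auto.
    + auto.
    + intros u. apply mid_set_ball; auto.
    + intros v. apply mid_set_ball; unfold ball; rewrite Ti; try apply Hball; auto.
  - intros h Hh. unfold phi. change (bdist (T (f + h)%alg) (T f) = norm h).
    rewrite Ti; auto. unfold bdist. f_equal; vec.
  - exists (T f - L f)%alg, L, (fun x => (T f - L f + L x)%alg). split.
    + constructor; auto.
    + exists (d / 2). split; [lra|]. intros x Hx.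
      assert (E : L (x - f)%alg = (L x - L f)%alg).
      { destruct Llin as [La Ls]. unfold sub. rewrite La, !opp_rscal, Ls. reflexivity. }
      replace (T x) with (T f + phi (x - f))%alg.
      * rewrite <- HL by exact Hx. rewrite E. vec.
      * unfold phi. replace (f + (x - f))%alg with x by vec. vec.
Qed.

(* Two real affine maps agreeing near a point agree everywhere. *)
Lemma affine_germ_unique {A B : BanachAlg} c L G c' L' (G' : A -> B) (f : A) :
  affine_isometry c L G -> affine_isometry c' L' G' -> germ G G' f -> forall x, G x = G' x.
Proof.
  intros [[La Ls] _ HG] [[La' Ls'] _ HG'] [d [Hd H]] x.
  destruct (Req_dec (norm (x - f)) 0) as [H0|H0].
  { apply H. unfold bdist; lra. }
  pose proof (norm_ge0 _ (x - f)%alg) as Hn.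
  (* This puts [f + s (x - f)] at distance [d / 2] from [f], where the two maps agree. *)
  set (s := d / (2 * norm (x - f))).
  assert (Hs : 0 < s) by (apply Rdiv_lt_0_compat; lra).
  assert (Hsn : s * norm (x - f) = d / 2) by (unfold s; field; lra).
  pose proof (H f) as E1. unfold bdist at 1 in E1.
  replace (f - f)%alg with (zero : A) in E1 by vec. rewrite norm_zero in E1. specialize (E1 Hd).
  assert (E2 : G (f + s *: (x - f))%alg = G' (f + s *: (x - f))%alg).
  { apply H. unfold bdist. replace (f + s *: (x - f) - f)%alg with (s *: (x - f))%alg by vec.
    rewrite norm_rscal, Rabs_pos_eq; lra. }
  rewrite !HG, !HG' in *. unfold sub in E2.
  rewrite La, La', Ls, Ls', La, La', !opp_rscal, Ls, Ls' in E2.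
  transitivity (c + L f + (/ s) *: ((c + (L f + s *: (L x + (-1) *: L f))) - (c + L f)))%alg; [vec|].
  rewrite E2, E1. vec.
Qed.

(** * Continuation of germs along segments *)

(** Connectedness of the unit interval: [Q] is locally constant, so the supremum [m] of the [t] with
    [Q] on all of [[0, t]] satisfies [Q] and cannot be less than 1. *)
Lemma unit_interval_induction (Q : R -> Prop) :
  Q 0 ->
  (forall t, 0 <= t <= 1 -> exists e, 0 < e /\
     forall s, 0 <= s <= 1 -> Rabs (s - t) < e -> (Q s <-> Q t)) ->
  Q 1.
Proof.
  intros H0 Hloc.
  set (S := fun t => 0 <= t <= 1 /\ forall s, 0 <= s <= t -> Q s).
  assert (S0 : S 0).
  { split; [lra|]. intros s Hs. replace s with 0 by lra. exact H0. }
  destruct (completeness S) as [m [Hub Hlub]].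
  { exists 1. intros t [Ht _]. lra. }
  { exists 0. exact S0. }
  assert (Hm : 0 <= m <= 1).
  { split; [apply Hub, S0|]. apply Hlub. intros t [Ht _]. lra. }
  destruct (Hloc m Hm) as [e [He HQ]].
  assert (Hbelow : forall s, 0 <= s < m -> Q s).
  { intros s Hs. apply NNPP; intro Hn.
    assert (m <= s); [|lra]. apply Hlub. intros t [Ht1 Ht2].
    destruct (Rle_lt_dec t s) as [|Hlt]; [assumption|]. exfalso; apply Hn, Ht2. lra. }
  assert (HQm : Q m).
  { destruct (Rle_lt_or_eq_dec 0 m (proj1 Hm)) as [Hlt|<-]; [|exact H0].
    set (s := Rmax 0 (m - e / 2)).
    assert (Hs : 0 <= s < m) by (unfold s; split; [apply Rmax_l|apply Rmax_lub_lt; lra]).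
    assert (m - e / 2 <= s) by apply Rmax_r.
    apply (HQ s); [lra|rewrite Rabs_left; lra|apply Hbelow, Hs]. }
  (* A point beyond [m], capped at 1; since [m' <= m], the cap must be active and [m = 1]. *)
  set (m' := Rmin 1 (m + e / 2)).
  assert (Hm1 : m' <= 1) by apply Rmin_l.
  assert (Hm2 : m' <= m + e / 2) by apply Rmin_r.
  assert (Hm3 : m <= m') by (apply Rmin_glb; lra).
  assert (HS : forall s, 0 <= s <= m' -> Q s).
  { intros s Hs. destruct (Rlt_le_dec s m) as [Hlt|Hge]; [apply Hbelow; lra|].
    apply HQ; [lra|rewrite Rabs_pos_eq; lra|exact HQm]. }
  assert (Hm4 : m' <= m) by (apply Hub; split; [lra|exact HS]).
  apply HS. split; [lra|]. unfold m', Rmin in *. destruct Rle_dec; lra.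
Qed.

Lemma germ_near {A B : BanachAlg} (T G : A -> B) f d x :
  (forall x, bdist x f < d -> T x = G x) -> bdist x f < d -> germ T G x.
Proof.
  intros H Hx. exists (d - bdist x f). split; [lra|]. intros y Hy. apply H.
  unfold bdist in *. pose proof (norm_sub_triangle _ y x f). lra.
Qed.

Lemma germ_common {A B : BanachAlg} (T G G' : A -> B) f :
  germ T G f -> germ T G' f -> germ G G' f.
Proof.
  intros [d1 [Hd1 H1]] [d2 [Hd2 H2]]. exists (Rmin d1 d2).
  split; [apply Rmin_glb_lt; assumption|]. intros x Hx.
  rewrite <- H1, <- H2; [reflexivity| |]; apply (Rlt_le_trans _ _ _ Hx);
    [apply Rmin_r|apply Rmin_l].
Qed.

Lemma germ_value {A B : BanachAlg} (T G : A -> B) f : germ T G f -> T f = G f.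
Proof.
  intros [d [Hd H]]. apply H. unfold bdist, sub. rewrite add_oppr, norm_zero. exact Hd.
Qed.

(** Near each point of the segment [T] is some affine [G']. If [G] is the germ at one nearby point
    then [G = G'] everywhere, so having germ [G] is a locally constant property along the
    segment. *)
Lemma germ_segment {A B : BanachAlg} (U : A -> Prop) (W : B -> Prop) (T : A -> B)
    c L G (x y : A) :
  iso_between U W T -> is_open U -> is_open W -> affine_isometry c L G ->
  (forall t, 0 <= t <= 1 -> U (x + t *: (y - x))%alg) ->
  germ T G x -> germ T G y.
Proof.
  intros HT HU HW HG Hseg Hx.
  set (p := fun t => (x + t *: (y - x))%alg).
  assert (Hp : forall s t, bdist (p s) (p t) = Rabs (s - t) * norm (y - x)).
  { intros s t. rewrite <- norm_rscal. unfold bdist, p. f_equal; vec. }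
  replace y with (p 1) by (unfold p; vec).
  apply (unit_interval_induction (fun t => germ T G (p t))).
  { replace (p 0) with x by (unfold p; vec). exact Hx. }
  intros t Ht.
  destruct (local_mazur_ulam U W T (p t) HT HU HW (Hseg t Ht)) as [c' [L' [G' [HG' Hg]]]].
  destruct Hg as [d [Hd Hg]].
  pose proof (norm_ge0 _ (y - x)%alg) as Hn.
  (* Adding 1 keeps the divisor positive when [x = y]. *)
  exists (d / (norm (y - x) + 1)). split; [apply Rdiv_lt_0_compat; lra|].
  intros s _ Hst.
  assert (Hs : bdist (p s) (p t) < d).
  { rewrite Hp. pose proof (Rabs_pos (s - t)).
    apply (Rmult_lt_compat_r (norm (y - x) + 1)) in Hst; [|lra].
    unfold Rdiv in Hst. rewrite Rmult_assoc, Rinv_l, Rmult_1_r in Hst by lra. nra. }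
  assert (Ht' : bdist (p t) (p t) < d).
  { unfold bdist, sub. rewrite add_oppr, norm_zero. exact Hd. }
  assert (Hmove : forall a b, bdist (p a) (p t) < d -> bdist (p b) (p t) < d ->
            germ T G (p a) -> germ T G (p b)).
  { intros a b Ha Hb Hga.
    pose proof (affine_germ_unique _ _ _ _ _ _ _ HG HG'
      (germ_common _ _ _ _ Hga (germ_near _ _ _ _ _ Hg Ha))) as Heq.
    destruct (germ_near _ _ _ _ _ Hg Hb) as [d' [Hd' H']].
    exists d'; split; [exact Hd'|]. intros z Hz. rewrite Heq. auto. }
  split; apply Hmove; assumption.
Qed.

(** * Quasinilpotent elements of commutative algebras *)

Section Quasinilpotent.
Variable A : BanachAlg.
Hypothesis Acomm : commutative A.
Implicit Types x y z : A.

(** Complex scalars become algebra elements, so that [ring] can treat scalar multiples as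
    products. *)
Definition emb (c : Defs.C) : A := scal c one.

Lemma scal_emb c x : scal c x = (emb c * x)%alg.
Proof. unfold emb. rewrite mul_scall, mul_1l; reflexivity. Qed.

Lemma emb_mul c d : emb (Cmul c d) = (emb c * emb d)%alg.
Proof. rewrite <- scal_emb. unfold emb. rewrite scal_assoc; reflexivity. Qed.

Lemma emb_add c d : emb (Cadd c d) = (emb c + emb d)%alg.
Proof. unfold emb. apply scal_addl. Qed.

Lemma emb_opp_one : emb (RtoC (-1)) = (- one)%alg.
Proof. unfold emb. rewrite opp_rscal. reflexivity. Qed.

Lemma norm_emb c : norm (emb c) = Cmod c.
Proof. unfold emb. rewrite norm_scal, norm_one; ring. Qed.

Lemma alg_ring_theory : ring_theory (zero : A) one add mul sub opp eq.
Proof.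
  constructor; intros.
  - apply add_0l.
  - apply add_comm.
  - apply add_assoc.
  - apply mul_1l.
  - apply Acomm.
  - apply mul_assoc.
  - apply mul_addl.
  - reflexivity.
  - apply add_oppr.
Qed.
Add Ring alg_ring : alg_ring_theory.

(** * Averages of the resolvent over roots of unity *)

(** This is [x^(2^k)]; with exponents that are powers of two, averaging over roots of unity reduces
    to repeated two-term averages. *)
Fixpoint sqpow (k : nat) (x : A) : A :=
  match k with O => x | S k => (sqpow k x * sqpow k x)%alg end.

Lemma sqpow_mul k x y : sqpow k (x * y)%alg = (sqpow k x * sqpow k y)%alg.
Proof. induction k as [|k IH]; simpl; [reflexivity|]. rewrite IH. ring. Qed.

Lemma norm_sqpow k x : norm (sqpow k x) <= norm x ^ (2 ^ k).
Proof.
  induction k as [|k IH]; simpl; [lra|].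
  rewrite Nat.add_0_r, pow_add. pose proof (norm_ge0 _ (sqpow k x)).
  eapply Rle_trans; [apply norm_mul|]. apply Rmult_le_compat; assumption.
Qed.

Lemma sqpow_S k x : sqpow (S k) x = sqpow k (x * x)%alg.
Proof. rewrite sqpow_mul. reflexivity. Qed.

Definition cexp (t : R) : Defs.C := (cos t, sin t).

Lemma cexp_add s t : cexp (s + t) = Cmul (cexp s) (cexp t).
Proof.
  apply C_ext; unfold cexp, Cmul; simpl; [rewrite cos_plus|rewrite sin_plus]; ring.
Qed.

Lemma Cmod_cexp t : Cmod (cexp t) = 1.
Proof.
  unfold Cmod, cexp; simpl. pose proof (sin2_cos2 t) as H. unfold Rsqr in H.
  replace (cos t * cos t + sin t * sin t) with 1 by lra. apply sqrt_1.
Qed.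

Lemma sqpow_cexp k t : sqpow k (emb (cexp t)) = emb (cexp (2 ^ k * t)).
Proof.
  revert t; induction k as [|k IH]; intro t.
  - simpl. rewrite Rmult_1_l; reflexivity.
  - rewrite sqpow_S, <- emb_mul, <- cexp_add, IH. f_equal. f_equal. simpl; ring.
Qed.

(** Multiplying [c] by this root flips the sign of [(c a)^(2^k)], as the recursion of [rho_avg]
    requires. *)
Lemma sqpow_root_of_minus_one k : sqpow k (emb (cexp (PI / 2 ^ k))) = (- one)%alg.
Proof.
  rewrite sqpow_cexp, <- emb_opp_one. f_equal.
  pose proof (pow_lt 2 k ltac:(lra)).
  replace (2 ^ k * (PI / 2 ^ k)) with PI by (field; lra).
  apply C_ext; unfold cexp, RtoC; simpl; [apply cos_PI|apply sin_PI].
Qed.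

Variable a : A.
Variable rho : Defs.C -> A.
Hypothesis Hrho : forall c, ((one - emb c * a) * rho c)%alg = one.

Lemma resolvent_identity c d :
  (rho c - rho d)%alg = ((emb c - emb d) * (rho c * a * rho d))%alg.
Proof.
  transitivity (rho c * ((one - emb d * a) * rho d) - (one - emb c * a) * rho c * rho d)%alg.
  - rewrite !Hrho; ring.
  - ring.
Qed.

(* The average of [rho] over the orbit of [c] under multiplication by the
   [2^k]-th roots of unity, which is the inverse of [1 - (c a)^(2^k)]. *)
Fixpoint rho_avg (k : nat) (c : Defs.C) : A :=
  match k with
  | O => rho c
  | S k => ((/2) *: (rho_avg k c + rho_avg k (Cmul (cexp (PI / 2 ^ k)) c)))%alg
  end.

(** Partial fractions with [z = (c a)^(2^k)]: the average of the inverses of [1 - z] and [1 + z] is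
    an inverse of [1 - z^2]. *)
Lemma rho_avg_inverse k c : ((one - sqpow k (emb c * a)) * rho_avg k c)%alg = one.
Proof.
  revert c; induction k as [|k IH]; intro c; simpl; [apply Hrho|].
  pose proof (IH c) as H1. pose proof (IH (Cmul (cexp (PI / 2 ^ k)) c)) as H2.
  rewrite emb_mul, <- mul_assoc, sqpow_mul, sqpow_root_of_minus_one in H2.
  set (z := sqpow k (emb c * a)) in *. set (u := rho_avg k c) in *.
  set (v := rho_avg k (Cmul _ _)) in *.
  rewrite mul_scalr.
  replace ((one - z * z) * (u + v))%alg
    with ((one + z) * ((one - z) * u) + (one - z) * ((one - - one * z) * v))%alg by ring.
  rewrite H1, H2. mul_expand. vec.
Qed.

Lemma Cmul_phase (w : Defs.C) (s t : R) :
  Cmod w = 1 -> norm (emb (Cmul w (RtoC s)) - emb (Cmul w (RtoC t))) = Rabs (s - t).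
Proof.
  intro Hw.
  replace (emb (Cmul w (RtoC s)) - emb (Cmul w (RtoC t)))%alg
    with (scal w ((s - t) *: (one : A))).
  - rewrite norm_scal, norm_rscal, norm_one, Hw; ring.
  - rewrite !emb_mul, scal_emb.
    replace ((s - t) *: (one : A)) with (emb (RtoC s) - emb (RtoC t))%alg
      by (unfold emb; vec).
    ring.
Qed.

Lemma Cmod_mul c d : Cmod (Cmul c d) = Cmod c * Cmod d.
Proof. rewrite <- !norm_emb, emb_mul, <- scal_emb, norm_scal, !norm_emb; reflexivity. Qed.

Section BoundedResolvent.
Variables (r K : R).
Hypothesis Hr : 0 < r.
Hypothesis HK : forall c, Cmod c <= r -> norm (rho c) <= K.

(** For [k = 0] the constant comes from the resolvent identity, and averaging does not increase it,
    so it is uniform in [k]. The unimodular [w] absorbs the rotations in the recursion. *)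
Lemma rho_avg_equicontinuous k w s t :
  Cmod w = 1 -> 0 <= s <= r -> 0 <= t <= r ->
  norm (rho_avg k (Cmul w (RtoC s)) - rho_avg k (Cmul w (RtoC t)))
    <= K * norm a * K * Rabs (s - t).
Proof.
  revert w; induction k as [|k IH]; intros w Hw Hs Ht; simpl.
  - rewrite resolvent_identity.
    eapply Rle_trans; [apply norm_mul|]. rewrite Cmul_phase by exact Hw.
    rewrite Rmult_comm. apply Rmult_le_compat_r; [apply Rabs_pos|].
    assert (B1 : norm (rho (Cmul w (RtoC s))) <= K).
    { apply HK. rewrite Cmod_mul, Hw, Cmod_RtoC, Rabs_pos_eq; lra. }
    assert (B2 : norm (rho (Cmul w (RtoC t))) <= K).
    { apply HK. rewrite Cmod_mul, Hw, Cmod_RtoC, Rabs_pos_eq; lra. }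
    eapply Rle_trans; [apply norm_mul|].
    apply Rmult_le_compat; try apply norm_ge0; [|exact B2].
    eapply Rle_trans; [apply norm_mul|].
    apply Rmult_le_compat_r; [apply norm_ge0|exact B1].
  - set (z := cexp (PI / 2 ^ k)).
    assert (Hz : Cmod (Cmul z w) = 1) by (rewrite Cmod_mul, Hw; unfold z; rewrite Cmod_cexp; ring).
    assert (E : forall q, Cmul z (Cmul w q) = Cmul (Cmul z w) q).
    { intro q. apply C_ext; unfold Cmul; simpl; ring. }
    rewrite !E.
    pose proof (IH w Hw Hs Ht) as H1. pose proof (IH _ Hz Hs Ht) as H2.
    match goal with |- norm ((/2) *: (?p + ?q) - (/2) *: (?p' + ?q')) <= _ =>
      replace ((/2) *: (p + q) - (/2) *: (p' + q'))%alg
        with ((/2) *: ((p - p') + (q - q')))%alg by vec;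
      pose proof (norm_triangle _ (p - p') (q - q'))%alg
    end.
    rewrite norm_rscal, Rabs_pos_eq by lra. lra.
Qed.

Lemma sqpow_small x (e : R) : norm x < 1 -> 0 < e -> exists k, norm (sqpow k x) <= e.
Proof.
  intros Hx He. pose proof (norm_ge0 _ x) as H0.
  destruct (pow_lt_1_zero (norm x) ltac:(rewrite Rabs_pos_eq; lra) e He) as [N HN].
  assert (HN2 : (N <= 2 ^ N)%nat) by (apply Nat.lt_le_incl, Nat.pow_gt_lin_r; lia).
  exists N. specialize (HN _ HN2). rewrite Rabs_pos_eq in HN by (apply pow_le; lra).
  pose proof (norm_sqpow N x). lra.
Qed.

Lemma sqpow_comp j k x : sqpow j (sqpow k x) = sqpow (j + k) x.
Proof. induction j as [|j IH]; simpl; [reflexivity|]. rewrite IH; reflexivity. Qed.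

(** Equivalently, the spectral radius of [s a] is less than 1. *)
Definition eventually_small (s : R) : Prop := exists k, norm (sqpow k (s *: a)) < 1.

Lemma rho_avg_one k (s : R) : rho_avg k (RtoC s) = rho_avg k (Cmul Defs.C1 (RtoC s)).
Proof. f_equal. apply C_ext; unfold Cmul, Defs.C1, RtoC; simpl; ring. Qed.

Lemma Cmod_C1 : Cmod Defs.C1 = 1.
Proof. rewrite <- Rabs_R1. apply Cmod_RtoC. Qed.

(* Rickart's argument: if [(s a)^(2^k)] is small then [rho_avg k s] is near [one]; by
   equicontinuity so is [rho_avg k t], which bounds [(t a)^(2^k)].  The step length does
   not depend on [s], so smallness spreads from [0] to all of [0, r]. *)
Lemma eventually_small_step s t :
  0 <= s <= r -> 0 <= t <= r -> K * norm a * K * Rabs (s - t) <= / 8 ->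
  eventually_small s -> eventually_small t.
Proof.
  intros Hs Ht Hst [k0 Hk0].
  (* If [norm p <= 1/5] then [norm (u - 1) <= 1/4]; the step adds at most [1/8], so
     [norm (v - 1) <= 3/8] and [norm q <= (3/8) / (5/8) < 1]. *)
  destruct (sqpow_small _ (/5) Hk0 ltac:(lra)) as [j Hj].
  rewrite sqpow_comp in Hj. set (k := (j + k0)%nat) in *. clearbody k.
  exists k.
  pose proof (rho_avg_equicontinuous k Defs.C1 s t Cmod_C1 Hs Ht) as He.
  rewrite <- !rho_avg_one in He.
  pose proof (rho_avg_inverse k (RtoC s)) as Is. pose proof (rho_avg_inverse k (RtoC t)) as It.
  rewrite <- !scal_emb in *.
  set (p := sqpow k (s *: a)) in *. set (q := sqpow k (t *: a)) in *.
  set (u := rho_avg k (RtoC s)) in *. set (v := rho_avg k (RtoC t)) in *.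
  assert (Eu : (u - one)%alg = (p + p * (u - one))%alg).
  { transitivity (u - (one - p) * u)%alg; [rewrite Is; reflexivity|ring]. }
  assert (Eq : q = (v - one - q * (v - one))%alg).
  { transitivity (q + ((one - q) * v - one))%alg; [rewrite It|]; ring. }
  pose proof (norm_triangle _ p (p * (u - one)))%alg as N1. rewrite <- Eu in N1.
  pose proof (norm_mul _ p (u - one))%alg as N2.
  pose proof (norm_ge0 _ (u - one)%alg) as G1.
  pose proof (norm_sub_triangle _ v u one) as N3. rewrite (norm_sub_sym _ v u) in N3.
  pose proof (norm_triangle _ (v - one) (- (q * (v - one))))%alg as N4.
  rewrite norm_opp in N4. change (v - one + - (q * (v - one)))%alg with (v - one - q * (v - one))%alg in N4.
  rewrite <- Eq in N4.
  pose proof (norm_mul _ q (v - one))%alg as N5.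
  pose proof (norm_ge0 _ q) as G2. pose proof (norm_ge0 _ p) as G3.
  assert (norm (u - one) <= /4) by nra.
  assert (norm (v - one) <= 3/8) by lra.
  nra.
Qed.

(** Walk from 0 to [r] in [N] equal steps, with [N] so large that each step meets the [1/8] bound of
    [eventually_small_step]. *)
Lemma eventually_small_radius : eventually_small r.
Proof.
  set (M := K * norm a * K).
  destruct (archimed_cor1 (/ (8 * r * (Rabs M + 1)))) as [N [HN HN0]].
  { apply Rinv_0_lt_compat. pose proof (Rabs_pos M). nra. }
  assert (HN1 : 0 < INR N) by (apply lt_0_INR; exact HN0).
  pose proof (Rabs_pos M) as HM.
  assert (Hstep : M * (r / INR N) <= / 8).
  { apply Rmult_lt_compat_r with (r := r) in HN; [|exact Hr].
    assert (E : / (8 * r * (Rabs M + 1)) * r = / 8 * / (Rabs M + 1)) by (field; lra).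
    rewrite E in HN.
    assert (H1 : (Rabs M + 1) * (/ INR N * r) < / 8).
    { apply (Rmult_lt_reg_r (/ (Rabs M + 1))); [apply Rinv_0_lt_compat; lra|].
      replace ((Rabs M + 1) * (/ INR N * r) * / (Rabs M + 1)) with (/ INR N * r) by (field; lra).
      exact HN. }
    pose proof (Rle_abs M). pose proof (Rinv_0_lt_compat _ HN1).
    assert (0 < / INR N * r) by (apply Rmult_lt_0_compat; assumption).
    unfold Rdiv. rewrite (Rmult_comm r). nra. }
  assert (H : forall n, (n <= N)%nat -> eventually_small (INR n * (r / INR N))).
  { induction n as [|n IH]; intro Hn.
    - exists O. simpl. rewrite Rmult_0_l, rscal_0, norm_zero. lra.
    - assert (Hrange : forall m, (m <= N)%nat -> 0 <= INR m * (r / INR N) <= r).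
      { intros m Hm. apply le_INR in Hm. pose proof (pos_INR m).
        pose proof (Rdiv_lt_0_compat _ _ Hr HN1) as Hq.
        assert (r = INR N * (r / INR N)) by (field; lra). split; nra. }
      refine (eventually_small_step _ _ (Hrange n _) (Hrange (S n) Hn) _ (IH _)); try lia.
      fold M. rewrite S_INR.
      replace (INR n * (r / INR N) - (INR n + 1) * (r / INR N)) with (- (r / INR N)) by ring.
      rewrite Rabs_Ropp, Rabs_pos_eq; [exact Hstep|].
      left; apply Rdiv_lt_0_compat; assumption. }
  specialize (H N (le_n _)). replace (INR N * (r / INR N)) with r in H by (field; lra).
  exact H.
Qed.

End BoundedResolvent.

(** * Local boundedness of the resolvent and the resulting inverses *)

Lemma Cmod_le_sum (x y : R) : Cmod (x, y) <= Rabs x + Rabs y.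
Proof.
  unfold Cmod; simpl. pose proof (Rabs_pos x). pose proof (Rabs_pos y).
  rewrite <- (sqrt_square (Rabs x + Rabs y)) by lra. apply sqrt_le_1_alt.
  pose proof (Rsqr_abs x) as Hx. pose proof (Rsqr_abs y) as Hy. unfold Rsqr in Hx, Hy. nra.
Qed.

Lemma Rabs_fst_le_Cmod (c : Defs.C) : Rabs (fst c) <= Cmod c.
Proof.
  rewrite <- sqrt_Rsqr_abs. unfold Cmod, Rsqr. apply sqrt_le_1_alt. nra.
Qed.

Lemma Rabs_snd_le_Cmod (c : Defs.C) : Rabs (snd c) <= Cmod c.
Proof.
  rewrite <- sqrt_Rsqr_abs. unfold Cmod, Rsqr. apply sqrt_le_1_alt. nra.
Qed.

Lemma norm_emb_sub_le (x y u v : R) :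
  norm (emb (x, y) - emb (u, v)) <= Rabs (x - u) + Rabs (y - v).
Proof.
  replace (emb (x, y) - emb (u, v))%alg with (emb (x - u, y - v)).
  - rewrite norm_emb. apply Cmod_le_sum.
  - apply (add_cancel _ (emb (u, v))). rewrite <- emb_add.
    transitivity (emb (x, y)); [f_equal; apply C_ext; unfold Cadd; simpl; ring|ring].
Qed.

(** Near [(u, v)], within the gauge [delta], the resolvent identity gives [norm (rho (x, y)) <= 2 *
    norm (rho (u, v))]. Compactness of the square bounds the gauges in use below by one [d], and
    [1 / d] dominates these norms. *)
Lemma resolvent_bounded (r : R) : exists K, forall c, Cmod c <= r -> norm (rho c) <= K.
Proof.
  assert (Hpos : forall u v, 0 < / (4 * (norm a + 1) * (norm (rho (u, v)) + 1))).
  { intros u v. pose proof (norm_ge0 _ a). pose proof (norm_ge0 _ (rho (u, v))).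
    apply Rinv_0_lt_compat. nra. }
  destruct (Compactness.compactness_value_2d (- r) r (- r) r
              (fun u v => mkposreal _ (Hpos u v))) as [d Hd].
  exists (/ d). intros [x y] Hc.
  pose proof (Rabs_fst_le_Cmod (x, y)) as Hx. pose proof (Rabs_snd_le_Cmod (x, y)) as Hy.
  simpl in Hx, Hy.
  assert (Hx' : - r <= x <= r) by (unfold Rabs in Hx; destruct Rcase_abs in Hx; lra).
  assert (Hy' : - r <= y <= r) by (unfold Rabs in Hy; destruct Rcase_abs in Hy; lra).
  (* Compactness supplies [(u, v)] only under a double negation, so the goal is first negated. *)
  apply NNPP; intro Hn. apply (Hd x y Hx' Hy').
  intros [u [v [_ [_ [Hxu [Hyv Hdd]]]]]]. simpl in Hxu, Hyv, Hdd. apply Hn; clear Hn Hd.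
  pose proof (norm_emb_sub_le x y u v) as E. pose proof (Hpos u v) as Hp.
  pose proof (norm_ge0 _ a) as Na. pose proof (norm_ge0 _ (rho (u, v))) as Nu.
  pose proof (norm_ge0 _ (rho (x, y))) as Nx.
  assert (Hinv : / (4 * (norm a + 1) * (norm (rho (u, v)) + 1))
            * (4 * (norm a + 1) * (norm (rho (u, v)) + 1)) = 1) by (apply Rinv_l; nra).
  assert (Hle : 4 * (norm a + 1) * (norm (rho (u, v)) + 1) <= / d).
  { rewrite <- (Rinv_inv (4 * (norm a + 1) * (norm (rho (u, v)) + 1))).
    apply Rinv_le_contravar; [apply cond_pos|exact Hdd]. }
  set (delta := / (4 * (norm a + 1) * (norm (rho (u, v)) + 1))) in *. clearbody delta.
  assert (Hres : norm (rho (x, y)) <= norm (rho (u, v))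
     + norm (emb (x, y) - emb (u, v)) * (norm (rho (x, y)) * norm a * norm (rho (u, v)))).
  { assert (E1 : rho (x, y) = (rho (u, v) + (emb (x, y) - emb (u, v))
                   * (rho (x, y) * a * rho (u, v)))%alg).
    { rewrite <- resolvent_identity. ring. }
    rewrite E1 at 1. eapply Rle_trans; [apply norm_triangle|].
    apply Rplus_le_compat_l. eapply Rle_trans; [apply norm_mul|].
    apply Rmult_le_compat_l; [apply norm_ge0|].
    eapply Rle_trans; [apply norm_mul|].
    apply Rmult_le_compat_r; [assumption|apply norm_mul]. }
  set (X := norm (rho (x, y))) in *. set (n0 := norm (rho (u, v))) in *.
  set (e := norm (emb (x, y) - emb (u, v))) in *. set (na := norm a) in *.
  clearbody X n0 e na.
  assert (He : e * (na * n0) <= / 2).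
  { assert (0 <= na * n0) by nra. assert (e * (na * n0) <= 2 * delta * (na * n0)) by nra.
    assert (2 * delta * (na * n0) <= 2 * delta * ((na + 1) * (n0 + 1))) by nra. nra. }
  nra.
Qed.

Lemma sqpow_rscal k (r : R) x : sqpow k (r *: x) = r ^ (2 ^ k) *: sqpow k x.
Proof.
  induction k as [|k IH]; simpl sqpow.
  - simpl. rewrite Rmult_1_r; reflexivity.
  - rewrite IH, mul_scall, mul_scalr, rscal_assoc, <- pow_add. f_equal. f_equal. f_equal.
    simpl; lia.
Qed.

Lemma one_minus_sqpow_factor k x : exists w, (one - sqpow k x)%alg = ((one - x) * w)%alg.
Proof.
  induction k as [|k [w Hw]]; simpl.
  - exists one. ring.
  - exists (w * (one + sqpow k x))%alg. rewrite mul_assoc, <- Hw. ring.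
Qed.

(** Smallness of [(r a)^(2^k)] at [r = norm b + 1] makes [(b a)^(2^k)] small by commutativity. Then
    [1 - (b a)^(2^k)] lies in [Omega], is invertible by hypothesis, and has [1 - b a] as a
    factor. *)
Lemma one_minus_mul_invertible b :
  (forall f : A, Omega f -> invertible f) -> invertible (one - b * a)%alg.
Proof.
  intro HOm. pose proof (norm_ge0 _ b) as Hb.
  destruct (resolvent_bounded (norm b + 1)) as [K HK].
  destruct (eventually_small_radius (norm b + 1) K ltac:(lra) HK) as [k Hk].
  assert (Hs : norm (sqpow k (b * a)) < 1).
  { rewrite sqpow_rscal, norm_rscal, Rabs_pos_eq in Hk by (apply pow_le; lra).
    rewrite sqpow_mul. eapply Rle_lt_trans; [apply norm_mul|].
    eapply Rle_lt_trans; [|exact Hk].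
    apply Rmult_le_compat_r; [apply norm_ge0|].
    eapply Rle_trans; [apply norm_sqpow|]. apply pow_incr. lra. }
  destruct (HOm (one - sqpow k (b * a))%alg) as [y [Hy _]].
  { exists 1. split; [lra|]. unfold bdist.
    replace (one - sqpow k (b * a) - rone 1)%alg with (- sqpow k (b * a))%alg by vec.
    rewrite norm_opp. exact Hs. }
  destruct (one_minus_sqpow_factor k (b * a)%alg) as [w Hw].
  rewrite Hw, <- mul_assoc in Hy.
  exists (w * y)%alg. split; [exact Hy|]. rewrite Acomm. exact Hy.
Qed.

End Quasinilpotent.

(** * Membership in the Jacobson radical *)

(** If [M] omits [a], then [M + A a] is everything, so [1 = m + b a] and the invertible element
    [1 - b a] lies in [M], a contradiction. *)
Lemma jacobson_radical_intro (A : BanachAlg) (a : A) :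
  commutative A -> (forall b, invertible (one - b * a)%alg) -> jacobson_radical A a.
Proof.
  intros Hc Hinv M [[M0 [Madd Mmul]] [M1 Mmax]]. apply NNPP; intro Hna.
  destruct (Mmax (fun x => exists m b, M m /\ x = (m + b * a)%alg)) as [H|H].
  - split; [|split].
    + exists zero, zero. split; [exact M0|].
      rewrite <- (rscal_0 A zero) at 3. rewrite mul_scall. vec.
    + intros x y [m [b [Hm ->]]] [m' [b' [Hm' ->]]].
      exists (m + m')%alg, (b + b')%alg. split; [auto|]. rewrite mul_addl. vec.
    + intros c x [m [b [Hm ->]]].
      exists (c * m)%alg, (c * b)%alg. split; [auto|]. rewrite mul_addr, mul_assoc. reflexivity.
  - intros x Hx. exists x, zero. split; [exact Hx|].
    rewrite <- (rscal_0 A zero), mul_scall. vec.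
  - apply Hna, H. exists zero, one. split; [exact M0|]. rewrite mul_1l. vec.
  - destruct (H one) as [m [b [Hm E]]].
    destruct (Hinv b) as [y [_ Hy]]. apply M1. rewrite <- Hy. apply Mmul.
    replace (one - b * a)%alg with m; [exact Hm|]. rewrite E. vec.
Qed.

Lemma semisimple_quasinilpotent (A : BanachAlg) (a : A) :
  commutative A -> semisimple A -> (forall f : A, Omega f -> invertible f) ->
  (forall c : Defs.C, invertible (one - scal c a)%alg) -> a = zero.
Proof.
  intros Hc Hss HOm Hinv.
  destruct (choice (fun c y => ((one - emb A c * a) * y)%alg = one)) as [rho Hrho].
  { intro c. destruct (Hinv c) as [y [Hy _]]. exists y. rewrite <- scal_emb. exact Hy. }
  apply Hss, jacobson_radical_intro; [exact Hc|]. intro b.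
  apply (one_minus_mul_invertible A Hc a rho Hrho b HOm).
Qed.

(** * Isometries between stable sets of invertible elements *)

(** Each open ray stays in [U], so one affine germ governs it and gives a centre [c]. Comparing
    [r f] with [r f0] bounds the distance between two centres by a multiple of [r], for every
    [r > 0]. *)
Lemma radial_isometry {A B : BanachAlg} (U : A -> Prop) (W : B -> Prop) (T : A -> B) (f0 : A) :
  iso_between U W T -> is_open U -> is_open W ->
  (forall (r : R) f, 0 < r -> U f -> U (r *: f)) -> U f0 ->
  exists c, forall f, U f -> forall r, 0 < r -> T (r *: f) = (c + r *: (T f - c))%alg.
Proof.
  intros HT HU HW Hcone Hf0.
  assert (Hray : forall f, U f -> exists c, forall r, 0 < r ->
            T (r *: f) = (c + r *: (T f - c))%alg).
  { intros f Hf.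
    destruct (local_mazur_ulam U W T f HT HU HW Hf) as [c [L [G [HG Hg]]]].
    exists c. intros r Hr.
    assert (Hgr : germ T G (r *: f)).
    { apply (germ_segment U W T c L G f (r *: f)); auto. intros t Ht.
      replace (f + t *: (r *: f - f))%alg with (((1 - t) + t * r) *: f)%alg by vec.
      apply Hcone; [|exact Hf].
      destruct (Rle_lt_or_eq_dec t 1 (proj2 Ht)) as [Hlt|Heq]; nra. }
    rewrite (germ_value _ _ _ Hgr), (germ_value _ _ _ Hg).
    destruct HG as [[_ Ls] _ HG]. rewrite !HG, Ls. vec. }
  destruct (Hray f0 Hf0) as [c0 Hc0].
  exists c0. intros f Hf. destruct (Hray f Hf) as [c Hc].
  assert (E : c = c0); [|rewrite <- E; exact Hc].
  apply sub_eq0, (norm_small_eq0 _ _ (norm (f - f0) + norm (T f - c) + norm (T f0 - c0))).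
  intros r Hr. destruct HT as [_ [_ Ti]].
  pose proof (Ti (r *: f) (r *: f0) (Hcone r f Hr Hf) (Hcone r f0 Hr Hf0)) as H.
  unfold bdist in H. rewrite (Hc r Hr), (Hc0 r Hr) in H.
  replace (r *: f - r *: f0)%alg with (r *: (f - f0))%alg in H by vec.
  rewrite norm_rscal, Rabs_pos_eq in H by lra.
  replace (c - c0)%alg with ((c + r *: (T f - c) - (c0 + r *: (T f0 - c0)))
    + (r *: (T f0 - c0) + - (r *: (T f - c))))%alg by vec.
  eapply Rle_trans; [apply norm_triangle|]. rewrite H.
  pose proof (norm_triangle _ (r *: (T f0 - c0)) (- (r *: (T f - c))))%alg as H1.
  rewrite norm_opp, !norm_rscal, Rabs_pos_eq in H1 by lra. lra.
Qed.

(** * Geometry of [Omega] and of scalar-stable sets *)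

Lemma Omega_one (A : BanachAlg) : Omega (one : A).
Proof.
  exists 1. split; [lra|]. unfold bdist.
  replace (one - rone 1)%alg with (zero : A) by vec. rewrite norm_zero. lra.
Qed.

Lemma Omega_segment {A : BanachAlg} (h : A) (t : R) :
  Omega h -> 0 <= t <= 1 -> Omega (one + t *: (h - one))%alg.
Proof.
  intros [r [Hr Hh]] Ht. exists ((1 - t) + t * r). unfold bdist in *.
  replace (one + t *: (h - one) - rone (1 - t + t * r))%alg with (t *: (h - rone r))%alg by vec.
  rewrite norm_rscal, Rabs_pos_eq by lra.
  destruct (Rle_lt_or_eq_dec 0 t (proj1 Ht)) as [Hlt|Heq]; split; nra.
Qed.

Lemma Omega_add_rone {A : BanachAlg} (f : A) (r : R) : norm f < r -> Omega (f + rone r)%alg.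
Proof.
  intro H. exists r. pose proof (norm_ge0 _ f). split; [lra|]. unfold bdist.
  replace (f + rone r - rone r)%alg with f by vec. exact H.
Qed.

Lemma is_open_mul_invertible {B : BanachAlg} (V : B -> Prop) (g : B) :
  is_open V -> invertible g -> is_open (fun w => exists v, V v /\ w = (g * v)%alg).
Proof.
  intros HV [gi [Hg1 Hg2]] w [v [Hv ->]]. destruct (HV v Hv) as [e [He HVe]].
  pose proof (norm_ge0 _ gi) as Hn.
  exists (e / (norm gi + 1)). split; [apply Rdiv_lt_0_compat; lra|].
  intros y Hy. exists (gi * y)%alg. split.
  - apply HVe. unfold bdist in *.
    replace (gi * y - v)%alg with (gi * (y - g * v))%alg.
    + apply (Rmult_lt_compat_r (norm gi + 1)) in Hy; [|lra].
      unfold Rdiv in Hy. rewrite Rmult_assoc, Rinv_l, Rmult_1_r in Hy by lra.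
      pose proof (norm_mul _ gi (y - g * v))%alg. pose proof (norm_ge0 _ (y - g * v)%alg). nra.
    + unfold sub. rewrite mul_addr, !opp_rscal, mul_scalr, mul_assoc, Hg2, mul_1l.
      reflexivity.
  - rewrite mul_assoc, Hg1, mul_1l; reflexivity.
Qed.

Lemma Cinv_exists (c : Defs.C) : c <> C0 -> exists d, d <> C0 /\ Cmul c d = Defs.C1.
Proof.
  destruct c as [x y]. intro Hc.
  assert (H : x * x + y * y <> 0).
  { intro E. apply Hc. unfold C0. f_equal; nra. }
  exists (x / (x * x + y * y), - y / (x * x + y * y)).
  assert (E : Cmul (x, y) (x / (x * x + y * y), - y / (x * x + y * y)) = Defs.C1).
  { apply C_ext; unfold Cmul, Defs.C1; simpl; field; exact H. }
  split; [|exact E]. intro E0. rewrite E0 in E.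
  unfold Cmul, C0, Defs.C1 in E. simpl in E. injection E; lra.
Qed.

Lemma real_scal_stable {A : BanachAlg} (U : A -> Prop) :
  cstable U -> forall (r : R) f, r <> 0 -> U f -> U (r *: f).
Proof.
  intros HU r f Hr Hf. apply HU; [|exact Hf]. intro E. apply Hr. injection E; auto.
Qed.

(** For nonzero [c] with inverse [d], [1 - c a = -c (-d + a)], and [-d] lies in [U] as a nonzero
    multiple of [one]. *)
Lemma translation_invertible {A : BanachAlg} (U : A -> Prop) (a : A) :
  cstable U -> U one -> (forall f, U f -> invertible f) ->
  (forall f, U f -> U (f + a)%alg) -> forall c, invertible (one - scal c a)%alg.
Proof.
  intros HUc H1 Hinv Ha c.
  destruct (classic (c = C0)) as [->|Hc].
  - replace (one - scal C0 a)%alg with (one : A); [apply Hinv, H1|].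
    change C0 with (RtoC 0). vec.
  - destruct (Cinv_exists c Hc) as [d [Hd E]].
    pose (m := fun x : A => scal (Cmul c (RtoC (-1))) x).
    assert (Hm : forall x, m x = (- scal c x)%alg).
    { intro x. unfold m. rewrite <- scal_assoc, <- opp_rscal.
      apply (add_cancel _ (scal c x)). rewrite <- scal_addr, !add_oppr.
      apply norm_eq0. rewrite norm_scal, norm_zero. ring. }
    replace (one - scal c a)%alg with (m (scal d (- one) + a)%alg).
    + apply Hinv. unfold m. apply HUc.
      * intro E0. apply Hc. unfold Cmul, RtoC, C0 in E0. simpl in E0. injection E0; intros.
        apply C_ext; unfold C0; simpl; lra.
      * apply Ha, HUc; [exact Hd|]. rewrite opp_rscal. apply real_scal_stable; auto; lra.
    + rewrite Hm, scal_addr, scal_assoc, E, scal_1. vec.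
Qed.

Theorem theorem3p1 (A B : BanachAlg)
  (U : A -> Prop) (V : B -> Prop) (g : B) (T : A -> B)
  (hAcomm : commutative A) (hAss : semisimple A)
  (hUopen : is_open U)
  (hOmU : forall f, Omega f -> U f)
  (hUinv : forall f, U f -> invertible f)
  (hUc : cstable U)
  (hVopen : is_open V)
  (hOmV : forall a, Omega a -> V a)
  (hVinv : forall a, V a -> invertible a)
  (hVc : cstable V)
  (hVOm : forall v w, V v -> Omega w -> V (mul v w))
  (hg : invertible g)
  (hTmaps : forall f, U f -> exists v, V v /\ T f = mul g v)
  (hTonto : forall v, V v -> exists f, U f /\ T f = mul g v)
  (hTiso : forall f h, U f -> U h -> bdist (T f) (T h) = bdist f h) :
  exists S : A -> B,
    real_linear S /\ isometry S /\ surjective_onto S /\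
    (forall f, U f -> S f = T f).
Proof.
  set (W := fun w => exists v, V v /\ w = (g * v)%alg).
  assert (HT : iso_between U W T).
  { split; [|split]; [exact hTmaps| |exact hTiso].
    intros w [v [Hv ->]]. exact (hTonto v Hv). }
  assert (HWopen : is_open W) by (apply is_open_mul_invertible; assumption).
  assert (HW1 : W (g * one)%alg) by (exists one; split; [apply hOmV, Omega_one|reflexivity]).
  assert (HWcone : forall (r : R) w, 0 < r -> W w -> W (r *: w)).
  { intros r w Hr [v [Hv ->]]. exists (r *: v). split.
    - apply real_scal_stable; auto; lra.
    - rewrite mul_scalr; reflexivity. }
  assert (HU1 : U one) by (apply hOmU, Omega_one).
  destruct (iso_between_inverse A B U W T HT) as [P [HP [HTP HPT]]].
  (* Working with the inverse [P] places the centre [a] in [A], where semisimplicity is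
     available. *)
  destruct (radial_isometry W U P _ HP HWopen hUopen HWcone HW1) as [a Ha].
  assert (Ha0 : a = zero).
  { apply (semisimple_quasinilpotent A); auto.
    apply (translation_invertible U); auto.
    intros f Hf.
    assert (HTf : W (T f)) by (apply HT, Hf).
    (* The radial formula at ratio one half gives [P (T f / 2) = (f + a) / 2]. *)
    replace (f + a)%alg with (2 *: P ((/2) *: T f)).
    - apply real_scal_stable; [assumption|lra|]. apply HP, HWcone; [lra|exact HTf].
    - rewrite Ha, HPT by (assumption || lra). vec. }
  assert (HTpos : forall f r, U f -> 0 < r -> T (r *: f) = r *: T f).
  { intros f r Hf Hr. assert (HTf : W (T f)) by (apply HT, Hf).
    rewrite <- (HTP (r *: T f)) by (apply HWcone; assumption).
    rewrite Ha, HPT, Ha0 by assumption. f_equal. vec. }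
  destruct (local_mazur_ulam U W T one HT hUopen HWopen HU1) as [c [L [G [HG Hg]]]].
  (* On the ray through [one], [T] is both homogeneous and affine; comparing the values at [1] and
     [1 + d / 2] yields [(d / 2) c = 0]. *)
  assert (Hc : c = zero).
  { destruct Hg as [d [Hd Hg]].
    assert (Hval : forall r, 0 <= r < d -> T ((1 + r) *: one) = (c + (1 + r) *: L one)%alg).
    { intros r Hr. rewrite Hg.
      - rewrite (aff_eq _ _ _ HG). destruct (aff_linear _ _ _ HG) as [_ Ls].
        rewrite Ls; reflexivity.
      - unfold bdist. replace ((1 + r) *: one - one)%alg with (r *: (one : A)) by vec.
        rewrite norm_rscal, norm_one, Rabs_pos_eq; lra. }
    pose proof (Hval (d / 2) ltac:(lra)) as E1. pose proof (Hval 0 ltac:(lra)) as E2.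
    rewrite HTpos in E1, E2 by (auto; lra).
    assert (E3 : T one = (c + L one)%alg).
    { transitivity ((1 + 0) *: T one); [vec|]. rewrite E2. vec. }
    rewrite E3 in E1.
    transitivity ((2 / d) *: ((1 + d / 2) *: (c + L one) - (c + (1 + d / 2) *: L one)))%alg;
      [vec|].
    rewrite E1. vec. }
  destruct HG as [Llin Liso HG]. assert (HL := Llin). destruct HL as [Ladd Lscal].
  assert (HGL : forall x, G x = L x) by (intro x; rewrite HG, Hc, add_0l; reflexivity).
  assert (HGa : affine_isometry c L G) by (constructor; assumption).
  assert (Lsub : forall x y, L (x - y)%alg = (L x - L y)%alg).
  { intros x y. unfold sub. rewrite Ladd, !opp_rscal, Lscal; reflexivity. }
  assert (Lsurj : surjective_onto L).
  (* For small [e], [T one + e y] lies in the open set [W]; its preimage [x] is close to [one],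
     where [T = L], so [L] sends [(x - one) / e] to [y]. *)
  { intro y. destruct (HWopen (T one) (proj1 HT one HU1)) as [e1 [He1 HWe]].
    destruct Hg as [d [Hd Hg]]. pose proof (norm_ge0 _ y) as Hy.
    set (e := Rmin e1 d / (2 * (norm y + 1))).
    assert (Hm : 0 < Rmin e1 d) by (apply Rmin_glb_lt; assumption).
    assert (He : 0 < e) by (apply Rdiv_lt_0_compat; lra).
    assert (Hey : e * norm y < Rmin e1 d).
    { assert (E : e * (norm y + 1) = Rmin e1 d / 2) by (unfold e; field; lra). nra. }
    assert (Hn : norm (T one + e *: y - T one) = e * norm y).
    { replace (T one + e *: y - T one)%alg with (e *: y) by vec.
      rewrite norm_rscal, Rabs_pos_eq; lra. }
    pose proof (Rmin_l e1 d). pose proof (Rmin_r e1 d).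
    destruct (proj1 (proj2 HT) (T one + e *: y)%alg) as [x [Hx Ex]].
    { apply HWe. unfold bdist. lra. }
    assert (Hxd : bdist x one < d).
    { rewrite <- hTiso, Ex by assumption. unfold bdist. lra. }
    exists ((/ e) *: (x - one))%alg.
    rewrite Lscal, Lsub, <- !HGL, <- (Hg x Hxd), Ex.
    rewrite <- (germ_value T G one) by (exists d; auto). vec. }
  assert (HOm : forall h, Omega h -> T h = L h).
  { intros h Hh. rewrite <- HGL. apply germ_value.
    apply (germ_segment U W T c L G one h); auto.
    intros t Ht. apply hOmU, Omega_segment; assumption. }
  assert (Hgm : germ T G ((-1) *: one)).
  { pose (i := scal (0, 1) (one : A)).
    (* Both segments of the detour through [i] consist of nonzero complex multiples of [one],
       whereas the direct segment to [-one] meets [zero]. *)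
    assert (Hline : forall p q : R, p <> 0 \/ q <> 0 -> U (p *: one + q *: i)%alg).
    { intros p q Hpq.
      replace (p *: one + q *: i)%alg with (scal (p, q) (one : A)).
      - apply hUc; [|exact HU1]. intro E. injection E; intros; lra.
      - unfold i. rewrite scal_assoc, <- scal_addl. f_equal.
        apply C_ext; unfold Cadd, Cmul, RtoC; simpl; ring. }
    assert (Hi : germ T G i).
    { apply (germ_segment U W T c L G one i); auto. intros t Ht.
      replace (one + t *: (i - one))%alg with ((1 - t) *: one + t *: i)%alg by vec.
      apply Hline. destruct (Req_dec t 0); [left|right]; lra. }
    apply (germ_segment U W T c L G i); auto. intros t Ht.
    replace (i + t *: ((-1) *: one - i))%alg with ((- t) *: one + (1 - t) *: i)%alg by vec.
    apply Hline. destruct (Req_dec t 0); [right|left]; lra. }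
  assert (HOmm : forall h, Omega h -> T ((-1) *: h) = L ((-1) *: h)).
  { intros h Hh. rewrite <- HGL. apply germ_value.
    apply (germ_segment U W T c L G ((-1) *: one)); auto.
    intros t Ht.
    replace ((-1) *: one + t *: ((-1) *: h - (-1) *: one))%alg
      with ((-1) *: (one + t *: (h - one)))%alg by vec.
    apply real_scal_stable; [assumption|lra|]. apply hOmU, Omega_segment; assumption. }
  exists L. split; [exact Llin|]. split; [exact Liso|]. split; [exact Lsurj|].
  intros f Hf. destruct (Lsurj (T f - L f)%alg) as [d Hd].
  (* Comparing [f] with [f + r] and [f - r], where [T] is already known, gives
     [norm (r - d) = norm (r + d) = r], so [d / r = 0] by extremality of the unit. *)
  set (r := norm f + 1). pose proof (norm_ge0 _ f) as Hn.
  assert (Hr : 0 < r) by (unfold r; lra).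
  assert (Lnorm : forall x, norm (L x) = norm x).
  { intro x. pose proof (Liso x zero) as E. unfold bdist in E. rewrite <- Lsub in E.
    replace (x - zero)%alg with x in E by vec. exact E. }
  assert (Hfd : T f = L (f + d)%alg) by (rewrite Ladd, Hd; vec).
  assert (Hcomp : forall h, U h -> T h = L h -> norm (f + d - h) = norm (f - h)).
  { intros h Hh Eh. rewrite <- (Lnorm (f + d - h)%alg), Lsub, <- Hfd, <- Eh.
    exact (hTiso f h Hf Hh). }
  assert (Hscale : forall x : A, norm x = r -> norm ((/ r) *: x) <= 1).
  { intros x Hx. rewrite norm_rscal, Hx, Rabs_pos_eq by (left; apply Rinv_0_lt_compat, Hr).
    rewrite Rinv_l; lra. }
  assert (Hz : (/ r) *: d = zero).
  { assert (O1 : Omega (f + rone r)%alg) by (apply Omega_add_rone; unfold r; lra).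
    (* The point [f - r] is handled as the negative of [-f + r], which lies in [Omega]. *)
    assert (O2 : Omega ((-1) *: f + rone r)%alg).
    { apply Omega_add_rone. rewrite norm_rscal, Rabs_left by lra. unfold r; lra. }
    apply one_extreme.
    - replace (one + (/ r) *: d)%alg with ((/ r) *: (f + d - (-1) *: ((-1) *: f + rone r)))%alg
        by vec.
      apply Hscale. rewrite Hcomp; [|apply real_scal_stable; auto; lra|auto].
      replace (f - (-1) *: ((-1) *: f + rone r))%alg with (rone r : A) by vec.
      rewrite norm_rone, Rabs_pos_eq; lra.
    - replace (one - (/ r) *: d)%alg with ((/ r) *: (- (f + d - (f + rone r))))%alg by vec.
      apply Hscale. rewrite norm_opp, Hcomp by auto.
      replace (f - (f + rone r))%alg with (- rone r : A)%alg by vec.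
      rewrite norm_opp, norm_rone, Rabs_pos_eq; lra. }
  rewrite Hfd. f_equal.
  replace d with (r *: ((/ r) *: d)) by vec. rewrite Hz. vec.
Qed.
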